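(* Let $n,k\ge1$ and let $Y\in\mathbb{R}^{n\times k}$ be an observed matrix. Let $Q=Y^\top Y$ and let $D\in\mathbb{R}^{k\times k}$ be the diagonal matrix defined, according to the noise model assumed on $Y$, by $$D=\begin{cases} n\sigma^2 I_k & \text{(homoscedastic Gaussian noise)},\\ \operatorname{diag}(V^\top\mathbf{1}_n) & \text{(heteroscedastic Gaussian noise)},\\ \operatorname{diag}(Y^\top\mathbf{1}_n) & \text{(Poisson noise)},\\ \operatorname{diag}((aY+b)^\top\mathbf{1}_n) & \text{(mixed Poisson-Gaussian noise)}.\end{cases}$$ For $\Theta\in\mathbb{R}^{k\times k}$ let $$\operatorname{URE}_\Theta(Y)=\|Y\Theta-Y\|_F^2+2\operatorname{tr}(D\Theta)-\operatorname{tr}(D).$$ If $Q$ is positive definite, then $$\mathop{\arg\min}_{\Theta\in\mathbb{R}^{k\times k}}\operatorname{URE}_\Theta(Y)=I_k-Q^{-1}D,$$ $$\mathop{\arg\min}_{\Theta\in\mathbb{R}^{k\times k},\ \Theta^\top\mathbf{1}_k=\mathbf{1}_k}\operatorname{URE}_\Theta(Y)=I_k-\left[Q^{-1}-\frac{Q^{-1}\mathbf{1}_k(Q^{-1}\mathbf{1}_k)^\top}{\langle Q^{-1},\mathbf{1}_k\mathbf{1}_k^\top\rangle_F}\right]D .$$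
   Context: $\|\cdot\|_F$ and $\langle A,B\rangle_F=\operatorname{tr}(A^\top B)$ are the Frobenius norm and inner product, $\mathbf{1}_m$ is the all-ones vector in $\mathbb{R}^m$, $I_k$ the identity, $\operatorname{diag}(v)$ the diagonal matrix with diagonal $v$. Here $\sigma>0$, $V$ is a fixed $n\times k$ matrix with positive entries, and $a,b>0$ are scalars. The noise models, with $X$ the unknown clean matrix, are: homoscedastic Gaussian $Y_{i,j}\sim\mathcal{N}(X_{i,j},\sigma^2)$; heteroscedastic Gaussian $Y_{i,j}\sim\mathcal{N}(X_{i,j},V_{i,j})$; Poisson $Y_{i,j}\sim\mathcal{P}(X_{i,j})$; mixed $Y_{i,j}\sim a\mathcal{P}(X_{i,j}/a)+\mathcal{N}(0,b)$. They serve only to select the formula for $D$; the minimization is over $\Theta$ for a given (fixed) realization $Y$. In $aY+b$ the scalar $b$ is added to every entry. *)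

(* Defs.v *)
From HB Require Import structures.
From mathcomp Require Import all_boot all_order all_algebra.
From mathcomp Require Import classical_sets reals.

Set Implicit Arguments.
Unset Strict Implicit.
Unset Printing Implicit Defensive.

Import Order.TTheory GRing.Theory Num.Theory.
Local Open Scope ring_scope.
Local Open Scope classical_set_scope.

Definition ones (R : realType) (m : nat) : 'cV[R]_m := const_mx 1.

Definition frobenius_inner (R : realType) (m n : nat) (A B : 'M[R]_(m, n)) : R :=
  \tr (A^T *m B).

Definition frobenius_norm (R : realType) (m n : nat) (A : 'M[R]_(m, n)) : R :=
  Num.sqrt (frobenius_inner A A).

(* diag_mx takes a row vector, whereas v is a column vector here. *)
Definition diag (R : realType) (m : nat) (v : 'cV[R]_m) : 'M[R]_m :=
  diag_mx v^T.

Definition posdefmx (R : realType) (m : nat) (A : 'M[R]_m) : Prop :=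
  A^T = A /\ forall v : 'cV[R]_m, v != 0 -> 0 < (v^T *m A *m v) 0 0.

(* With X the clean matrix, the noise models are
     Homoscedastic:   Y i j ~ N(X i j, sigma^2)
     Heteroscedastic: Y i j ~ N(X i j, V i j)
     Poisson:         Y i j ~ P(X i j)
     Mixed:           Y i j ~ a * P(X i j / a) + N(0, b)
   Only their parameters enter the risk estimate, through noise_diag: the
   minimization is over Theta for a fixed realization Y. *)
Inductive noise_model (R : realType) (n k : nat) : Type :=
| Homoscedastic (sigma : R) of 0 < sigma
| Heteroscedastic (V : 'M[R]_(n, k)) of (forall i j, 0 < V i j)
| Poisson
| Mixed (a b : R) of 0 < a & 0 < b.

Definition noise_diag (R : realType) (n k : nat)
    (N : noise_model R n k) (Y : 'M[R]_(n, k)) : 'M[R]_k :=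
  match N with
  | Homoscedastic sigma _ => (n%:R * sigma ^+ 2) *: 1%:M
  | Heteroscedastic V _ => diag (V^T *m ones R n)
  | Poisson => diag (Y^T *m ones R n)
  | Mixed a b _ _ => diag ((a *: Y + const_mx b)^T *m ones R n)
  end.

Definition URE (R : realType) (n k : nat) (N : noise_model R n k)
    (Y : 'M[R]_(n, k)) (Theta : 'M[R]_k) : R :=
  frobenius_norm (Y *m Theta - Y) ^+ 2
  + 2 * \tr (noise_diag N Y *m Theta) - \tr (noise_diag N Y).

(* The set of all minimizers, so that "argmin = x" reads argmin f S = [set x]. *)
Definition argmin (R : realType) (T : Type) (f : T -> R) (S : set T) : set T :=
  [set x | S x /\ forall y, S y -> f x <= f y].

(* Main.v *)
Require Import Defs.
From HB Require Import structures.
From mathcomp Require Import all_boot all_order all_algebra.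
From mathcomp Require Import classical_sets reals.
From mathcomp Require Import ring.

Set Implicit Arguments.
Unset Strict Implicit.
Unset Printing Implicit Defensive.

Import Order.TTheory GRing.Theory Num.Theory.
Local Open Scope ring_scope.
Local Open Scope classical_set_scope.

(* The risk estimate is a quadratic function of Theta: its second-order part is
   H |-> |Y H|_F^2, positive definite since Q is, and half its gradient is
   G = Q (Theta - I) + D.  Hence a point of an affine subspace where G is
   orthogonal to all feasible directions H is the unique minimizer there.  At the
   first claimed minimizer G = 0; at the second G = c^-1 1 (Q^-1 1)^T D with
   c = 1^T Q^-1 1, which is orthogonal to every H with H^T 1 = 0. *)

Lemma frobenius_innerE (R : realType) (m n : nat) (A B : 'M[R]_(m, n)) :
  frobenius_inner A B = \sum_j \sum_i A i j * B i j.
Proof.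
by apply: eq_bigr => j _; rewrite mxE; apply: eq_bigr => i _; rewrite mxE.
Qed.

Lemma frobenius_inner_ge0 (R : realType) (m n : nat) (A : 'M[R]_(m, n)) :
  0 <= frobenius_inner A A.
Proof.
rewrite frobenius_innerE; apply: sumr_ge0 => j _; apply: sumr_ge0 => i _.
by rewrite -expr2 sqr_ge0.
Qed.

Lemma frobenius_inner_eq0 (R : realType) (m n : nat) (A : 'M[R]_(m, n)) :
  frobenius_inner A A = 0 -> A = 0.
Proof.
have sq_ge0 i j : 0 <= A i j * A i j by rewrite -expr2 sqr_ge0.
rewrite frobenius_innerE => /eqP; rewrite psumr_eq0; last first.
  by move=> j _; apply: sumr_ge0.
move=> /allP A0; apply/matrixP => i j; rewrite mxE; apply/eqP.
have := A0 j (mem_index_enum _); rewrite /= psumr_eq0 //.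
by move=> /allP /(_ i (mem_index_enum _)) /=; rewrite mulf_eq0 orbb.
Qed.

Lemma frobenius_norm_sqr (R : realType) (m n : nat) (A : 'M[R]_(m, n)) :
  frobenius_norm A ^+ 2 = frobenius_inner A A.
Proof. by rewrite sqr_sqrtr // frobenius_inner_ge0. Qed.

Lemma frobenius_innerC (R : realType) (m n : nat) (A B : 'M[R]_(m, n)) :
  frobenius_inner A B = frobenius_inner B A.
Proof. by rewrite /frobenius_inner -mxtrace_tr trmx_mul trmxK. Qed.

Lemma frobenius_innerDl (R : realType) (m n : nat) (A B C : 'M[R]_(m, n)) :
  frobenius_inner (A + B) C = frobenius_inner A C + frobenius_inner B C.
Proof. by rewrite /frobenius_inner linearD mulmxDl linearD. Qed.

Lemma frobenius_inner_sqrD (R : realType) (m n : nat) (A B : 'M[R]_(m, n)) :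
  frobenius_inner (A + B) (A + B) =
  frobenius_inner A A + 2 * frobenius_inner A B + frobenius_inner B B.
Proof.
rewrite frobenius_innerDl ![frobenius_inner _ (A + B)]frobenius_innerC.
rewrite !frobenius_innerDl (frobenius_innerC B A); ring.
Qed.

(** A singular [A] would annihilate some nonzero row vector [v], and the quadratic form would vanish
    at [v^T]. *)
Lemma posdefmx_unit (R : realType) (m : nat) (A : 'M[R]_m) :
  posdefmx A -> A \in unitmx.
Proof.
case=> _ A_gt0; rewrite unitmxE unitfE; apply/det0P => -[v v_neq0 vA0].
have := A_gt0 v^T; rewrite trmxK vA0 mul0mx mxE ltxx => A_gt0v.
suff: false by [].
by apply: A_gt0v; rewrite trmx_eq0.
Qed.

(** Substituting [w = invmx A *m v], nonzero with [v], turns the form of [invmx A] at [v] into that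
    of [A] at [w]. *)
Lemma posdefmx_inv (R : realType) (m : nat) (A : 'M[R]_m) :
  posdefmx A -> posdefmx (invmx A).
Proof.
move=> Apos; have Aunit := posdefmx_unit Apos; case: Apos => Asym A_gt0.
have Vsym : (invmx A)^T = invmx A by rewrite trmx_inv Asym.
split=> // v v_neq0; have w_neq0 : invmx A *m v != 0.
  apply: contra_neq v_neq0 => w0.
  by rewrite -(mulKVmx Aunit v) w0 mulmx0.
by have := A_gt0 _ w_neq0; rewrite trmx_mul Vsym -!mulmxA mulKVmx.
Qed.

Lemma noise_diag_sym (R : realType) (n k : nat) (N : noise_model R n k)
    (Y : 'M[R]_(n, k)) : (noise_diag N Y)^T = noise_diag N Y.
Proof.
by case: N => *; rewrite /= /diag ?tr_diag_mx // linearZ /= trmx1.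
Qed.

Definition half_grad_URE (R : realType) (n k : nat) (N : noise_model R n k)
    (Y : 'M[R]_(n, k)) (Theta : 'M[R]_k) : 'M[R]_k :=
  Y^T *m Y *m (Theta - 1%:M) + noise_diag N Y.

(** The cross term of the squared norm becomes an inner product with [H] by moving [Y] to the other
    side as [Y^T]; the trace term becomes one because [noise_diag N Y] is symmetric. *)
Lemma URE_expansion (R : realType) (n k : nat) (N : noise_model R n k)
    (Y : 'M[R]_(n, k)) (Theta H : 'M[R]_k) :
  URE N Y (Theta + H) =
  URE N Y Theta + 2 * frobenius_inner (half_grad_URE N Y Theta) H
  + frobenius_inner (Y *m H) (Y *m H).
Proof.
rewrite /URE !frobenius_norm_sqr.
have -> : Y *m (Theta + H) - Y = (Y *m Theta - Y) + Y *m H.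
  by rewrite mulmxDr addrAC.
set E := Y *m Theta - Y; set F := Y *m H.
rewrite frobenius_inner_sqrD /half_grad_URE (frobenius_innerDl _ _ H).
have -> : frobenius_inner (Y^T *m Y *m (Theta - 1%:M)) H = frobenius_inner E F.
  rewrite /frobenius_inner /F /E -mulmxA mulmxBr mulmx1.
  by rewrite trmx_mul trmxK mulmxA.
rewrite [frobenius_inner (noise_diag N Y) H]/frobenius_inner noise_diag_sym.
rewrite mulmxDr linearD /=; ring.
Qed.

(** Stationarity kills the linear term of the expansion, so any [Z] in [S] exceeds the value at
    [Theta] by exactly the squared norm of [Y *m (Z - Theta)]. *)
Lemma argmin_URE_stationary (R : realType) (n k : nat) (N : noise_model R n k)
    (Y : 'M[R]_(n, k)) (S : set 'M[R]_k) (Theta : 'M[R]_k) :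
  Y^T *m Y \in unitmx -> S Theta ->
  (forall Z, S Z -> frobenius_inner (half_grad_URE N Y Theta) (Z - Theta) = 0) ->
  argmin (URE N Y) S = [set Theta].
Proof.
move=> Qunit STheta stat.
have URE_S Z : S Z -> URE N Y Z = URE N Y Theta +
    frobenius_inner (Y *m (Z - Theta)) (Y *m (Z - Theta)).
  by move=> SZ; rewrite -{1}(subrKC Theta Z) URE_expansion stat // mulr0 addr0.
apply/seteqP; split=> [Z [SZ Zmin] | _ -> /=]; last first.
  by split=> // Z /URE_S ->; rewrite lerDl frobenius_inner_ge0.
have := Zmin _ STheta; rewrite URE_S // gerDl => YH_le0.
have /frobenius_inner_eq0 YH0 :
    frobenius_inner (Y *m (Z - Theta)) (Y *m (Z - Theta)) = 0.
  by apply/eqP; rewrite eq_le YH_le0 frobenius_inner_ge0.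
(* [Y] is injective, with left inverse [invmx (Y^T *m Y) *m Y^T]. *)
apply/eqP; rewrite -subr_eq0 -(mulKmx Qunit (Z - Theta)) -mulmxA.
by rewrite YH0 !mulmx0.
Qed.

Theorem proposition5 (R : realType) (n k : nat) (n_ge1 : (1 <= n)%N)
    (k_ge1 : (1 <= k)%N) (Y : 'M[R]_(n, k)) (N : noise_model R n k) :
  let Q : 'M[R]_k := Y^T *m Y in
  let D : 'M[R]_k := noise_diag N Y in
  posdefmx Q ->
  argmin (URE N Y) [set: 'M[R]_k] = [set 1%:M - invmx Q *m D]
  /\
  argmin (URE N Y) [set Theta : 'M[R]_k | Theta^T *m ones R k = ones R k] =
    [set 1%:M -
       (invmx Q - (frobenius_inner (invmx Q) (ones R k *m (ones R k)^T))^-1 *: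
                    ((invmx Q *m ones R k) *m (invmx Q *m ones R k)^T)) *m D].
Proof.
move=> Q D Qpos; have Qunit := posdefmx_unit Qpos.
have [Vsym V_gt0] := posdefmx_inv Qpos.
have Dsym : D^T = D by exact: noise_diag_sym.
pose e := ones R k; pose u := invmx Q *m e.
have e_neq0 : e != 0.
  apply/eqP => /matrixP /(_ (Ordinal k_ge1) 0) /eqP.
  by rewrite !mxE oner_eq0.
rewrite -/e -/u; set c := frobenius_inner _ _.
(* By cyclicity of the trace, [c] is the only entry of this 1 by 1 matrix. *)
have cE : u^T *m e = c%:M.
  rewrite [LHS]mx11_scalar; congr (_%:M).
  by rewrite /c /frobenius_inner mulmxA mxtrace_mulC trace_mx11 mulmxA trmx_mul.
(* [c] is the form of [invmx Q] at [e], hence positive, so that [c^-1] is a true inverse. *)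
have c_neq0 : c != 0.
  have := V_gt0 e e_neq0.
  by rewrite -{1}Vsym -trmx_mul -/u cE mxE eqxx => /lt0r_neq0.
(* Both claimed minimizers have the form [1%:M - P *m D]. *)
have gradE P : half_grad_URE N Y (1%:M - P *m D) = D - Q *m P *m D.
  by rewrite /half_grad_URE addrC addrAC subrr sub0r mulmxN mulmxA.
split.
  apply: argmin_URE_stationary => // Z _; rewrite gradE mulmxV // mul1mx subrr.
  by rewrite /frobenius_inner trmx0 mul0mx mxtrace0.
set P := invmx Q - _.
have Psym : P^T = P by rewrite /P linearB linearZ /= trmx_mul trmxK Vsym.
(* The rank-one correction sends [e] to [c^-1 *: (u *m (u^T *m e)) = u], which is also
   [invmx Q *m e]. *)
have Pe0 : P *m e = 0.
  rewrite /P mulmxBl -scalemxAl -mulmxA cE mul_mx_scalar scalerA.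
  by rewrite mulVf // scale1r subrr.
have feasible : (1%:M - P *m D)^T *m e = e.
  by rewrite linearB /= trmx1 trmx_mul Dsym Psym mulmxBl mul1mx -mulmxA Pe0
    mulmx0 subr0.
apply: argmin_URE_stationary => // Z Ze.
(* The difference of two feasible points has zero column sums. *)
have eH0 : e^T *m (Z - (1%:M - P *m D)) = 0.
  by apply: trmx_inj; rewrite trmx_mul trmxK trmx0 linearB /= mulmxBl Ze feasible
    subrr.
have QP : Q *m P = 1%:M - c^-1 *: (e *m u^T).
  by rewrite /P mulmxBr mulmxV // -scalemxAr mulmxA mulKVmx.
(* What remains of the half gradient has left factor [e]; transposed, it puts [e^T] next to the
   direction, where [eH0] applies. *)
rewrite gradE QP mulmxBl mul1mx subKr /frobenius_inner trmx_mul linearZ /=.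
by rewrite trmx_mul -scalemxAr -scalemxAl -!mulmxA eH0 !mulmx0 scaler0 mxtrace0.
Qed.
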